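(* Let $q$ be a prime power. If $q$ is even, then for every integer $k$ with $1\le k\le q+1$ there exists an MDS maximal-entanglement EAQECC with parameters $[[q+1,\,k,\,q-k+2;\,q+1-k]]_q$. If $q$ is odd, then for every odd integer $k$ with $1\le k\le q+1$ there exists an MDS maximal-entanglement EAQECC with parameters $[[q+1,\,k,\,q-k+2;\,q+1-k]]_q$.
   Context: An $[[n,k,d;c]]_q$ entanglement-assisted quantum error-correcting code (EAQECC) encodes $k$ logical qudits into $n$ physical qudits using $c$ copies of maximally entangled states pre-shared between sender and receiver. In standard terms: with $\mathcal{H}=\mathbb{C}^q$ and $\Phi=q^{-1/2}\sum_{i}|i\rangle|i\rangle\in\mathcal{H}\otimes\mathcal{H}$, it is a subspace $Q=\{(U\otimes I)(|\psi\rangle\otimes|0\rangle^{\otimes (n-k-c)}\otimes\Phi^{\otimes c}):\psi\in\mathcal{H}^{\otimes k}\}$ of $\mathcal{H}^{\otimes n}\otimes\mathcal{H}^{\otimes c}$, where $U$ is a unitary on the sender's $n$ qudits (the $k$ data qudits, the $n-k-c$ ancillas and the sender's halves of the $c$ pairs) and $I$ acts on the receiver's $c$ halves, such that, with $P$ the orthogonal projector onto $Q$, for every operator $E$ on $\mathcal{H}^{\otimes n}$ acting nontrivially on at most $d-1$ qudits there is a scalar $\lambda_E$ with $P(E\otimes I)P=\lambda_E P$. An $[[n,k,d;c]]_q$ EAQECC is called MDS if $n+c-k=2(d-1)$. An EAQECC $[[n,2\kappa-n+c,d;c]]_q$ obtained from a classical $[n,\kappa]$ code is called maximal-entanglement if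 $c=n-\kappa$; equivalently, an $[[n,k,d;c]]_q$ EAQECC is maximal-entanglement if $c=n-k$. *)

(* Defs.v *)
From HB Require Import structures.
From mathcomp Require Import all_boot all_order all_algebra all_field.
From mathcomp Require Export complex reals.

Set Implicit Arguments.
Unset Strict Implicit.
Unset Printing Implicit Defensive.

Import GRing.Theory Num.Theory.

Local Open Scope ring_scope.

Section EAQECC.

Variables (C : numClosedFieldType) (q : nat).

(* The Hilbert space with orthonormal basis X: a vector is the family of its
   amplitudes. *)
Notation hilb X := {ffun X -> C^o}.

Definition inner (X : finType) (u v : hilb X) : C := \sum_x (u x)^* * v x.

Definition unitary (X : finType) (U : 'End(hilb X)) : Prop :=
  (forall u v, inner (U u) (U v) = inner u v) /\ limg U = fullv.

Definition orth_projector (X : finType) (Q : {vspace hilb X})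
    (P : 'End(hilb X)) : Prop :=
  [/\ (P \o P)%VF = P, forall u v, inner (P u) v = inner u (P v)
    & limg P = Q].

(* Qudits labelled by the finite type I: the computational basis of the
   I-indexed tensor power of C^q consists of the words I -> {0, .., q-1}. *)
Definition word (I : finType) := {ffun I -> 'I_q}.
Definition ket (I : finType) := hilb (word I).

(* The tensor product of the spaces of a sender with qudits I and a receiver
   with qudits J. *)
Definition biket (I J : finType) := hilb (word I * word J)%type.

(* A (x) id : A is applied to each slice with the receiver's word fixed. *)
Definition tens_id (I J : finType) (A : 'End(ket I)) (v : biket I J) :
    biket I J :=
  [ffun z => A [ffun x => v (x, z.2)] z.1].

Definition restrict (I : finType) (S : {set I}) (x : word I) :
    word {i | i \in S} :=
  [ffun i => x (val i)].

Definition overwrite (I : finType) (S : {set I}) (x : word I)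
    (s : word {i | i \in S}) : word I :=
  [ffun i => if insub i is Some j then s j else x i].

(* E = F (x) id for an operator F on the qudits in S. *)
Definition acts_on (I : finType) (S : {set I}) (E : 'End(ket I)) : Prop :=
  exists F : 'End(ket {i | i \in S}), forall (v : ket I) (x : word I),
    E v x = F [ffun s => v (overwrite x s)] (restrict S x).

(* Amplitudes of the one-qudit state |0> and of the maximally entangled
   two-qudit state Phi. *)
Definition zero_amp (x : 'I_q) : C := (x == 0%N :> nat)%:R.
Definition Phi_amp (x y : 'I_q) : C := (sqrtC q%:R)^-1 * (x == y)%:R.

(* psi (x) |0>^a (x) Phi^c: the sender's n qudits are, in this order, the k data
   qudits, the a ancillas and the sender's halves of the c pairs; the receiver
   holds the other halves. *)
Definition encoder_input (n k a c : nat) (en : (k + a + c = n)%N)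
    (psi : ket 'I_k) : biket 'I_n 'I_c :=
  [ffun z : word 'I_n * word 'I_c =>
     psi [ffun i => z.1 (cast_ord en (lshift c (lshift a i)))]
     * \prod_(i < a) zero_amp (z.1 (cast_ord en (lshift c (rshift k i))))
     * \prod_(j < c) Phi_amp (z.1 (cast_ord en (rshift (k + a) j))) (z.2 j)].

Definition is_EAQECC (n k d c : nat) (Q : {vspace biket 'I_n 'I_c}) : Prop :=
  (exists (a : nat) (en : (k + a + c = n)%N) (U : 'End(ket 'I_n)),
     unitary U /\
     forall v, v \in Q <-> exists psi, v = tens_id U (encoder_input en psi))
  /\
  (exists P : 'End(biket 'I_n 'I_c), orth_projector Q P /\
     forall (E : 'End(ket 'I_n)) (S : {set 'I_n}),
       (#|S| < d)%N -> acts_on S E ->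
       exists lambda : C, forall v, P (tens_id E (P v)) = lambda *: P v).

End EAQECC.

Definition MDS_params (n k d c : nat) : Prop :=
  n%:Z + c%:Z - k%:Z = 2 * (d%:Z - 1).

Definition max_entanglement_params (n k c : nat) : Prop :=
  c%:Z = n%:Z - k%:Z.

Definition MDS_max_entanglement_EAQECC_exists (C : numClosedFieldType)
    (q n k d c : nat) : Prop :=
  [/\ MDS_params n k d c, max_entanglement_params n k c
    & exists Q : {vspace biket C q 'I_n 'I_c}, is_EAQECC k d Q].

(* Main.v *)
(* A permutation unitary suffices. Let U |y, s> = |phi y s> for a bijection phi;
   the code is spanned by q^(-c/2) sum_s |phi y s>|s>. For E supported on at most
   c qudits, P (E (x) id) P is diagonal if, for fixed s, the words phi y s and
   phi y' s always agree in fewer than k places, and its diagonal is constant if,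
   for fixed y, the words phi y s and phi y s' always agree in fewer than c
   places: then s |-> phi y s is a bijection onto the words on any c places.
   Take phi y s = y G D + s H, with G and H generator matrices of the extended
   Reed-Solomon codes of length q + 1 and dimensions k and c, and D an invertible
   diagonal matrix making the two codes complementary. *)
Require Import Defs.
From mathcomp Require Import all_boot all_order all_algebra all_field.
From mathcomp Require Import complex reals.
From HB Require Import structures.
From mathcomp Require Import zify ring.
Set Implicit Arguments.
Unset Strict Implicit.
Unset Printing Implicit Defensive.

Import GRing.Theory Num.Theory.

Local Open Scope ring_scope.

(** * Schur complements and diagonal perturbations *)

Lemma det_schur (F : fieldType) m n (A : 'M[F]_m) B C (D : 'M[F]_n) :
  D \in unitmx ->
  \det (block_mx A B C D) = \det (A - B *m invmx D *m C) * \det D.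
Proof.
move=> uD; have -> : block_mx A B C D =
    block_mx (A - B *m invmx D *m C) B 0 D *m block_mx 1%:M 0 (invmx D *m C) 1%:M.
  by rewrite mulmx_block !mulmx1 !mulmx0 !add0r mulmxA subrK mulmxA
    mulmxV // mul1mx.
by rewrite det_mulmx det_ublock det_lblock !det1 !mulr1.
Qed.

(* Each new diagonal entry has to avoid 0 and the root of an affine function. *)
Lemma diag_perturbation_unit (F : finFieldType) n (M : 'M[F]_n) :
  (2 < #|F|)%N ->
  exists d : 'rV[F]_n, (forall i, d 0 i != 0) /\ diag_mx d + M \in unitmx.
Proof.
move=> F3; elim: n M => [|n IHn] M.
  by exists 0; split=> [[]//|]; rewrite unitmxE det_mx00 unitr1.
move: M; rewrite -[n.+1]/(1 + n)%N => M.
have [d' [d'0 ud']] := IHn (drsubmx M).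
set D := diag_mx d' + _ in ud'.
(* With [t] as the new diagonal entry, the Schur complement of the block [D] is the scalar
   [t + e]. *)
set e := (ulsubmx M - ursubmx M *m invmx D *m dlsubmx M) 0 0.
have [t t0 te] : exists2 t : F, t != 0 & t + e != 0.
  have /set0Pn[t] : ~: [set 0; - e] != set0.
    rewrite -card_gt0 -(ltn_add2l #|[set 0; - e]|) addn0 cardsC.
    by apply: leq_ltn_trans F3; rewrite cards2; case: (_ != _).
  rewrite !inE negb_or -addr_eq0 => /andP[]; by exists t.
exists (row_mx (t%:M : 'M_1) d'); split.
  move=> i; have [j ->|j ->] := split_ordP i.
    by rewrite row_mxEl mxE ord1 eqxx mulr1n.
  by rewrite row_mxEr.
rewrite -(submxK M) diag_mx_row add_block_mx !add0r unitmxE det_schur //.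
rewrite unitrM -(unitmxE D) ud' andbT unitfE det_mx11.
suff -> : (diag_mx (t%:M : 'M_1) + ulsubmx M -
  ursubmx M *m invmx D *m dlsubmx M) 0 0 = t + e by [].
by rewrite -addrA mxE /e; congr (_ + _); rewrite !mxE eqxx !mulr1n.
Qed.

(** * Extended Reed-Solomon codes *)

Definition zeros (F : fieldType) n (v : 'rV[F]_n) := [set i | v 0 i == 0].

Section ReedSolomon.
Variables (F : finFieldType) (n : nat) (pt : 'I_n -> option F).
Hypothesis pt_bij : bijective pt.

(* Generator matrix of the extended Reed-Solomon code; the point at infinity,
   None, reads off the coefficient of degree k - 1. *)
Definition rs_mx k : 'M[F]_(k, n) :=
  \matrix_(j, i) if pt i is Some x then x ^+ j else (j.+1 == k)%:R.

(** Finite zeros are roots of the message polynomial. A zero at infinity adds one more, but only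
    when the coefficient of degree [k - 1] vanishes, which lowers the bound on the number of roots
    by one. *)
Lemma rs_zeros k (y : 'rV[F]_k) :
  y != 0 -> (#|zeros (y *m rs_mx k)| < k)%N.
Proof.
move=> y0; set A := zeros _.
have p0 : rVpoly y != 0.
  by apply: contraNneq y0 => y0; rewrite -[y]rVpolyK y0 linear0.
pose Z := [set x | root (rVpoly y) x].
have ltZ : (#|Z| < size (rVpoly y))%N.
  rewrite cardE; apply: max_poly_roots => //; last exact: enum_uniq.
  by apply/allP => x; rewrite mem_enum inE.
have szk : (size (rVpoly y) <= k)%N by exact: size_poly.
have k0 : (0 < k)%N by apply: leq_trans szk; apply: leq_ltn_trans ltZ.
have evS i x : pt i = Some x -> (y *m rs_mx k) 0 i = (rVpoly y).[x].
  move=> pti; rewrite (horner_coef_wide _ szk) mxE; apply: eq_bigr => j _.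
  by rewrite !mxE pti coef_rVpoly_ord.
have evN i : pt i = None -> (y *m rs_mx k) 0 i = (rVpoly y)`_k.-1.
  move=> pti; have k1 : (k.-1 < k)%N by rewrite prednK.
  rewrite -[k.-1]/(val (Ordinal k1)) coef_rVpoly_ord mxE (bigD1 (Ordinal k1)) //=.
  rewrite mxE pti prednK // eqxx mulr1 big1 ?addr0 // => j ne_j.
  rewrite mxE pti (_ : (j.+1 == k) = false) ?mulr0 //.
  by apply: contraNF ne_j => /eqP ej; apply/eqP/val_inj; exact: (congr1 predn ej).
have szp : (rVpoly y)`_k.-1 = 0 -> (size (rVpoly y) < k)%N.
  move=> c0; rewrite ltn_neqAle szk andbT; apply: contra p0 => /eqP szE.
  by rewrite -lead_coef_eq0 lead_coefE szE c0.
rewrite -(card_imset _ (bij_inj pt_bij)).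
have some_inj : injective (@Some F) by move=> x x' [].
have [c0|c0] := eqVneq (rVpoly y)`_k.-1 0.
  apply: leq_ltn_trans (szp c0).
  apply: leq_trans ltZ; rewrite -(card_imset _ some_inj).
  apply: (@leq_trans #|None |: (Some @: Z)|).
    apply/subset_leq_card/subsetP => _ /imsetP[i + ->].
    rewrite !inE; case pti: (pt i) => [x|] //= /eqP; rewrite (evS _ _ pti) => px.
    by rewrite imset_f // inE; apply/eqP.
  by rewrite cardsU1 -[leqRHS]add1n leq_add2r; case: (_ \notin _).
apply: leq_trans szk; apply: leq_ltn_trans ltZ.
rewrite -(card_imset _ some_inj).
apply/subset_leq_card/subsetP => _ /imsetP[i + ->].
rewrite !inE; case pti: (pt i) => [x|] //= /eqP.
  by rewrite (evS _ _ pti) => px; rewrite imset_f // inE; apply/eqP.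
by rewrite (evN _ pti) => /eqP; rewrite (negbTE c0).
Qed.

(** A nonzero vector in the left kernel would give a nonzero message whose codeword vanishes at [k]
    places, against [rs_zeros]. *)
Lemma rs_cols_unit k (f : 'I_k -> 'I_n) :
  injective f -> colsub f (rs_mx k) \in unitmx.
Proof.
move=> f_inj; rewrite -row_free_unit -kermx_eq0; apply/eqP/row_matrixP => i.
rewrite row0; apply/eqP; apply: contraTT isT => /rs_zeros.
rewrite ltnNge (@leq_trans #|f @: 'I_k|) //.
  by rewrite card_imset ?card_ord.
apply/subset_leq_card/subsetP => _ /imsetP[j _ ->]; rewrite inE.
have /(congr1 (fun v : 'rV_k => v 0 j)): row i (kermx (colsub f (rs_mx k))) *m
  colsub f (rs_mx k) = 0 by rewrite -row_mul mulmx_ker row0.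
by rewrite mulmx_colsub !mxE => /eqP.
Qed.

End ReedSolomon.

(** * Complementary Reed-Solomon codes and the encoding map *)

Section Complement.
Variables (F : finFieldType) (k c : nat) (pt : 'I_(k + c) -> option F).
Hypothesis pt_bij : bijective pt.
Let V m := rs_mx pt m.

(** The claim is invertibility of the two generator matrices stacked into one square matrix. Its
    block [rsubmx (V c)] is invertible, and factoring the invertible [lsubmx (V k)] out of the Schur
    complement leaves a diagonal perturbation of a fixed matrix. *)
Lemma rs_complement_big : (2 < #|F|)%N ->
  exists d : 'rV[F]_(k + c), (forall i, d 0 i != 0) /\
    forall (y : 'rV_k) (s : 'rV_c),
      y *m V k *m diag_mx d + s *m V c = 0 -> y = 0 /\ s = 0.
Proof.
move=> F3.
have uA : lsubmx (V k) \in unitmx.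
  rewrite (_ : lsubmx _ = colsub (lshift c) (V k)).
    exact: (rs_cols_unit pt_bij (@lshift_inj k c)).
  by apply/matrixP => i j; rewrite !mxE.
have uD : rsubmx (V c) \in unitmx.
  rewrite (_ : rsubmx _ = colsub (@rshift k c) (V c)).
    exact: (rs_cols_unit pt_bij (@rshift_inj k c)).
  by apply/matrixP => i j; rewrite !mxE.
set X := rsubmx (V k) *m invmx (rsubmx (V c)) *m lsubmx (V c).
have [d [d0 ud]] := diag_perturbation_unit (- (invmx (lsubmx (V k)) *m X)) F3.
(* The twist is 1 on the last [c] columns, so [rsubmx (V k)], and with it [X], does not depend on
   [d]. *)
exists (row_mx d (const_mx 1)); split=> [i|y s].
  case: (split_ordP i) => j ->; first by rewrite row_mxEl.
  by rewrite row_mxEr mxE oner_eq0.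
rewrite -mulmxA -mul_row_col => ys0.
suff u : col_mx (V k *m diag_mx (row_mx d (const_mx 1 : 'rV_c))) (V c) \in unitmx.
  have : row_mx y s = 0 by rewrite -[row_mx y s](mulmxK u) ys0 mul0mx.
  by rewrite -row_mx0 => /eq_row_mx.
rewrite -[V k]hsubmxK -[V c]hsubmxK diag_mx_row mul_row_block !mulmx0 addr0 add0r.
rewrite diag_const_mx mulmx1 -/(block_mx _ _ _ _) unitmxE det_schur //.
rewrite -/X unitrM -(unitmxE (rsubmx (V c))) uD andbT.
have -> : lsubmx (V k) *m diag_mx d - X =
    lsubmx (V k) *m (diag_mx d - invmx (lsubmx (V k)) *m X).
  by rewrite mulmxBr mulKVmx.
by rewrite -unitmxE unitmx_mul uA.
Qed.

End Complement.

(* For #|F| = 2 no diagonal twist is available, but none is needed: the words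
   of rs_mx 2 satisfy w(1) = w(0) + w(oo), which no nonzero constant does. *)
Lemma rs_const_line (F : finFieldType) n (pt : 'I_n -> option F) :
  bijective pt ->
  forall (y : 'rV_1) (s : 'rV_2),
    y *m rs_mx pt 1 + s *m rs_mx pt 2 = 0 -> y = 0 /\ s = 0.
Proof.
case=> pt' ptK pt'K y s ys0.
have ev i : y 0 0 * rs_mx pt 1 0 i +
    (s 0 0 * rs_mx pt 2 0 i + s 0 1 * rs_mx pt 2 1 i) = 0.
  have := congr1 (fun v : 'rV_n => v 0 i) ys0.
  rewrite !mxE big_ord_recl big_ord0 addr0 big_ord_recl big_ord_recl big_ord0.
  rewrite addr0 (_ : lift ord0 ord0 = 1) => [<-|]; last exact: val_inj.
  by rewrite !mxE.
have := ev (pt' (Some 0)); have := ev (pt' (Some 1)); have := ev (pt' None).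
rewrite !mxE !pt'K /= !expr1 !expr0 !mulr1 !mulr0 !add0r addr0 => e1 e2 e3.
have s1 : s 0 1 = 0.
  have -> : s 0 1 = y 0 0 + (s 0 0 + s 0 1) - (y 0 0 + s 0 0) by ring.
  by rewrite e2 e3 subr0.
have y0 : y 0 0 = 0 by rewrite -e1 s1 addr0.
have s0 : s 0 0 = 0 by rewrite -e3 y0 add0r.
split; apply/rowP => j; rewrite mxE; first by rewrite ord1.
case: j => -[|[|//]] lt; [rewrite -[RHS]s0 | rewrite -[RHS]s1];
  by congr (s _ _); apply: val_inj.
Qed.

Lemma rs_complement (F : finFieldType) k c (pt : 'I_(k + c) -> option F) :
  bijective pt -> (0 < k)%N ->
  exists d : 'rV[F]_(k + c), (forall i, d 0 i != 0) /\
    forall (y : 'rV_k) (s : 'rV_c),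
      y *m rs_mx pt k *m diag_mx d + s *m rs_mx pt c = 0 ->
      y = 0 /\ s = 0.
Proof.
move=> pt_bij k0; have [F3|F2] := ltnP 2 #|F|; first exact: rs_complement_big.
have kc : (k + c <= 3)%N.
  by rewrite -[(k + c)%N]card_ord (bij_eq_card pt_bij) card_option ltnS.
exists (const_mx 1); split=> [i|y s]; first by rewrite mxE oner_eq0.
rewrite diag_const_mx mulmx1.
case: c pt pt_bij kc s => [|c] pt pt_bij kc s.
  rewrite (thinmx0 s) mul0mx addr0 => ys0; split=> //.
  apply/eqP; apply: contraTT isT => /(rs_zeros pt_bij).
  suff -> : zeros (y *m rs_mx pt k) = setT by rewrite cardsT card_ord addn0 ltnn.
  by apply/setP => i; rewrite !inE ys0 mxE eqxx.
have eqF : (k + c.+1 = #|F|.+1)%N.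
  by rewrite -card_option -(bij_eq_card pt_bij) card_ord.
have F1 : (1 < #|F|)%N := finNzRing_gt1 F.
(* Here [c] is one less than the second dimension: length 3 splits into dimensions 1 and 2, in
   either order. *)
have [[? ?]|[? ?]] : (k = 1 /\ c = 1)%N \/ (k = 2 /\ c = 0)%N by lia.
  by subst k c; exact: (rs_const_line pt_bij).
by subst k c; rewrite addrC => /(rs_const_line pt_bij)[].
Qed.

(** By linearity, two words agree exactly where the encoding of the difference of their messages
    vanishes. If one message is shared, that difference lies in a single Reed-Solomon code, up to a
    twist by nonzero entries that keeps its zeros. *)
Lemma rs_words (q k c : nat) (F : finFieldType) :
  #|F| = q -> (k + c = q.+1)%N -> (0 < k)%N ->
  exists phi : word q 'I_k -> word q 'I_c -> word q 'I_(k + c),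
    [/\ injective (fun w => phi w.1 w.2),
      forall y y' s, y != y' -> (#|[set i | phi y s i == phi y' s i]| < k)%N
    & forall y s s', s != s' -> (#|[set i | phi y s i == phi y s' i]| < c)%N].
Proof.
move=> cF kc k0.
have [h [h' hK h'K]] : exists h : 'I_q -> F, bijective h.
  by exists (fun i => enum_val (cast_ord (esym cF) i));
    apply: bij_comp (enum_val_bij F) _; exists (cast_ord cF) => i;
    apply: val_inj.
have cO : #|{: option F}| = (k + c)%N by rewrite card_option cF kc.
have [pt pt_bij] : exists pt : 'I_(k + c) -> option F, bijective pt.
  by exists (fun i => enum_val (cast_ord (esym cO) i));
    apply: bij_comp (enum_val_bij _) _; exists (cast_ord cO) => i;
    apply: val_inj.
have [d [d0 inj_d]] := rs_complement pt_bij k0.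
pose vec m (w : word q 'I_m) : 'rV[F]_m := \row_i h (w i).
have vec_inj m : injective (@vec m).
  move=> w w' /rowP e; apply/ffunP => i; have := e i; rewrite !mxE.
  exact: (can_inj hK).
pose enc (y : 'rV_k) (s : 'rV_c) :=
  y *m rs_mx pt k *m diag_mx d + s *m rs_mx pt c.
have encB y s y' s' : enc y s - enc y' s' = enc (y - y') (s - s').
  by rewrite /enc !mulmxBl opprD addrACA.
exists (fun y s => [ffun i => h' (enc (vec _ y) (vec _ s) 0 i)]); split.
- move=> [y s] [y' s'] /= /ffunP e.
  have /eqP : enc (vec _ y) (vec _ s) = enc (vec _ y') (vec _ s').
    by apply/rowP => i; have := e i; rewrite !ffunE => /(can_inj h'K).
  rewrite -subr_eq0 encB => /eqP/inj_d[/eqP + /eqP].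
  by rewrite !subr_eq0 => /eqP/vec_inj-> /eqP/vec_inj->.
- move=> y y' s ne.
  apply: leq_ltn_trans (_ : #|zeros ((vec _ y - vec _ y') *m rs_mx pt k)| < k)%N.
    apply/subset_leq_card/subsetP => i; rewrite !inE !ffunE (can_eq h'K).
    rewrite -subr_eq0.
    have -> : forall u v : 'rV[F]_(k + c), u 0 i - v 0 i = (u - v) 0 i.
      by move=> u v; rewrite !mxE.
    rewrite encB /enc subrr mul0mx addr0 mul_mx_diag mxE mulf_eq0.
    by rewrite (negbTE (d0 i)) orbF.
  by apply: rs_zeros; rewrite // subr_eq0 (inj_eq (@vec_inj _)).
move=> y s s' ne.
  apply: leq_ltn_trans (_ : #|zeros ((vec _ s - vec _ s') *m rs_mx pt c)| < c)%N.
  apply/subset_leq_card/subsetP => i; rewrite !inE !ffunE (can_eq h'K).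
  rewrite -subr_eq0.
  have -> : forall u v : 'rV[F]_(k + c), u 0 i - v 0 i = (u - v) 0 i.
    by move=> u v; rewrite !mxE.
  by rewrite encB /enc subrr !mul0mx add0r.
by apply: rs_zeros; rewrite // subr_eq0 (inj_eq (@vec_inj _)).
Qed.

(** * Words on subsets of the qudits *)

Lemma overwrite_restrict q (I : finType) (S : {set I}) (x : word q I) :
  overwrite x (Defs.restrict S x) = x.
Proof.
by apply/ffunP => i; rewrite ffunE; case: insubP => // j _ <-; rewrite ffunE.
Qed.

Lemma restrict_overwrite q (I : finType) (S : {set I}) (x : word q I)
  (t : word q {i | i \in S}) : Defs.restrict S (overwrite x t) = t.
Proof. by apply/ffunP => j; rewrite !ffunE valK. Qed.

Lemma overwrite_out q (I : finType) (S : {set I}) (x : word q I)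
  (t : word q {i | i \in S}) i : i \notin S -> overwrite x t i = x i.
Proof. by move=> Si; rewrite ffunE insubN. Qed.

Lemma restrict_overwrite_sub q (I : finType) (S T : {set I}) (x0 x : word q I) :
  S \subset T ->
  Defs.restrict S (overwrite x0 (Defs.restrict T x)) = Defs.restrict S x.
Proof.
move=> /subsetP sST; apply/ffunP => -[i Si]; rewrite !ffunE /=.
by case: insubP => [j _ <-|/negP[]]; [rewrite ffunE | exact: sST].
Qed.

Lemma superset_of_card (I : finType) (S : {set I}) m :
  (#|S| <= m <= #|I|)%N -> exists2 T : {set I}, S \subset T & #|T| = m.
Proof.
elim: m => [|m IHm] /andP[leS leI].
  by exists S => //; apply/eqP; rewrite -leqn0.
move: leS; rewrite leq_eqVlt => /predU1P[<-|leS]; first by exists S.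
have [|T sST cT] := IHm; first by rewrite -ltnS leS ltnW.
have /subsetPn[i _ Ti] : ~~ ([set: I] \subset T).
  by apply: contraL leI => /subset_leq_card; rewrite cardsT cT -leqNgt.
exists (i |: T); last by rewrite cardsU1 Ti cT.
by rewrite (subset_trans sST) ?subsetU1.
Qed.

(** * The code spanned by a permutation of basis words *)

Section PermutationCode.
Variables (C : numClosedFieldType) (q k c : nat).
Hypothesis q_gt0 : (0 < q)%N.
Variable phi : word q 'I_k -> word q 'I_c -> word q 'I_(k + c).
Hypothesis phi_inj : injective (fun w => phi w.1 w.2).
Hypothesis phi_l : forall y y' s,
  y != y' -> (#|[set i | phi y s i == phi y' s i]| < k)%N.
Hypothesis phi_r : forall y s s',
  s != s' -> (#|[set i | phi y s i == phi y s' i]| < c)%N.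

(** The number of ancillas is [n - k - c = 0]. *)
Let en : (k + 0 + c = k + c)%N. Proof. by rewrite addn0. Qed.

(** [data] and [half] read the sender's register in the layout of [encoder_input]; [glue] inverts
    the pair. *)
Let data (w : word q 'I_(k + c)) : word q 'I_k :=
  [ffun i => w (cast_ord en (lshift c (lshift 0 i)))].
Let half (w : word q 'I_(k + c)) : word q 'I_c :=
  [ffun j => w (cast_ord en (rshift (k + 0) j))].
Let glue (w : word q 'I_k * word q 'I_c) : word q 'I_(k + c) :=
  [ffun i => match split i with inl i => w.1 i | inr j => w.2 j end].

Lemma data_glue w : data (glue w) = w.1.
Proof.
apply/ffunP => i; rewrite !ffunE.
rewrite (_ : cast_ord _ _ = lshift c i) ?(unsplitK (inl i)) //; exact: val_inj.
Qed.

Lemma half_glue w : half (glue w) = w.2.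
Proof.
apply/ffunP => j; rewrite !ffunE.
rewrite (_ : cast_ord _ _ = rshift k j) ?(unsplitK (inr j)) //.
by apply: val_inj; rewrite /= addn0.
Qed.

Lemma glueK w : glue (data w, half w) = w.
Proof.
apply/ffunP => i; rewrite !ffunE; case: split_ordP => j -> /=; rewrite ffunE;
  by congr (w _); apply: val_inj; rewrite /= ?addn0.
Qed.

Lemma phi_bij : bijective (fun w => phi w.1 w.2).
Proof.
apply: inj_card_bij => //.
by rewrite card_prod !card_ffun !card_ord expnD.
Qed.

Lemma permutation_code_EAQECC :
  exists Q : {vspace biket C q 'I_(k + c) 'I_c}, is_EAQECC k c.+1 Q.
Proof.
have [psi phiK psiK] := phi_bij.
pose al : C := (sqrtC q%:R)^-1.
have al_conj : al^* = al.
  by apply/conj_Creal/ger0_real; rewrite invr_ge0 sqrtC_ge0 ler0n.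
have al2 : al * al * q%:R = 1.
  rewrite /al -expr2 exprVn sqrtCK mulVf // pnatr_eq0.
  by rewrite -lt0n.
(* The joint amplitude [q^(-c/2)] of the [c] pairs; [be2] normalises a sum over all receiver
   words. *)
pose be := al ^+ c.
have be_conj : be^* = be by rewrite /be rmorphXn /= al_conj.
have be2 : be * be *+ #|word q 'I_c| = 1.
  by rewrite card_ffun !card_ord -mulr_natr natrX /be -!exprMn al2 expr1n.
(* Permuting basis kets by [phi] acts on amplitudes by precomposition with its inverse [psi]. *)
pose Uf (v : ket C q 'I_(k + c)) : ket C q 'I_(k + c) :=
  [ffun x => v (glue (psi x))].
have Uf_lin : linear Uf by move=> a u v; apply/ffunP => x; rewrite !ffunE.
pose UL : {linear _ -> _} := HB.pack Uf (GRing.isLinear.Build _ _ _ _ Uf Uf_lin).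
pose U : 'End(ket C q 'I_(k + c)) := linfun UL.
have UE v x : U v x = v (glue (psi x)) by rewrite lfunE ffunE.
pose enc := @encoder_input C q _ k 0 c en.
have encE f w z : enc f (glue w, z) = be * f w.1 * (w.2 == z)%:R.
  rewrite ffunE /= big_ord0 mulr1 -/(data _) data_glue [be * _]mulrC -mulrA.
  congr (_ * _).
  have halfE j : glue w (cast_ord en (rshift (k + 0) j)) = w.2 j.
    by rewrite -(half_glue w) [RHS]ffunE.
  under eq_bigr do rewrite halfE.
  rewrite big_split prodr_const card_ord /=; congr (_ * _).
  have [<-|ne] := eqVneq w.2 z; first by rewrite big1 // => j _; rewrite eqxx.
  have /existsP[j nej] : [exists j, w.2 j != z j].
    rewrite -negb_forall; apply: contra ne => /forallP e.
    by apply/eqP/ffunP => j; apply/eqP.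
  by rewrite (bigD1 j) //= (negbTE nej) mul0r.
(* [W] is the whole encoding as an isometry from the data space, and [V] below is its adjoint. Hence
   [V W = 1], and [W V] is the orthogonal projector onto the code. *)
pose Wf (f : ket C q 'I_k) : biket C q 'I_(k + c) 'I_c :=
  [ffun z => be * f (psi z.1).1 * ((psi z.1).2 == z.2)%:R].
have Wf_lin : linear Wf.
  move=> a u v; apply/ffunP => x; rewrite !ffunE mulrDr mulrDl.
  by congr (_ + _); rewrite -[RHS]/(_ * _) -[_ *: _]/(_ * _) !mulrA [be * a]mulrC.
pose WL : {linear _ -> _} := HB.pack Wf (GRing.isLinear.Build _ _ _ _ Wf Wf_lin).
pose W : 'Hom(ket C q 'I_k, biket C q 'I_(k + c) 'I_c) := linfun WL.
have WE f z : W f z = be * f (psi z.1).1 * ((psi z.1).2 == z.2)%:R.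
  by rewrite lfunE ffunE.
have W_enc f : W f = tens_id U (enc f).
  by apply/ffunP => z; rewrite WE ffunE UE ffunE encE.
pose Vf (v : biket C q 'I_(k + c) 'I_c) : ket C q 'I_k :=
  [ffun y => be * \sum_s v (phi y s, s)].
have Vf_lin : linear Vf.
  move=> a u v; apply/ffunP => y; rewrite !ffunE.
  under eq_bigr do rewrite !ffunE.
  by rewrite big_split mulrDr -scaler_sumr /= -!/(_ * _) mulrCA.
pose VL : {linear _ -> _} := HB.pack Vf (GRing.isLinear.Build _ _ _ _ Vf Vf_lin).
pose V : 'Hom(biket C q 'I_(k + c) 'I_c, ket C q 'I_k) := linfun VL.
have VE v y : V v y = be * \sum_s v (phi y s, s) by rewrite lfunE ffunE.
have psi_phi y s : psi (phi y s) = (y, s) by exact: (phiK (y, s)).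
have WK f : V (W f) = f.
  apply/ffunP => y; rewrite VE.
  under eq_bigr => s _ do rewrite WE /= psi_phi /= eqxx mulr1.
  by rewrite sumr_const mulrnAr mulrA -mulrnAl be2 mul1r.
have W_adj f v : inner (W f) v = inner f (V v).
  rewrite /inner (eq_bigr (fun z => (W f (z.1, z.2))^* * v (z.1, z.2)));
    last by case.
  rewrite -(pair_bigA _ (fun x z => (W f (x, z))^* * v (x, z))) /=.
  rewrite (reindex (fun w => phi w.1 w.2)) /=; last first.
    exact/onW_bij/phi_bij.
  rewrite -(pair_bigA _ (fun y s => \sum_z (W f (phi y s, z))^* * v (phi y s, z))).
  apply: eq_bigr => y _; rewrite VE mulrA mulr_sumr; apply: eq_bigr => s _.
  rewrite (bigD1 s) //= big1 ?addr0 => [|z ne].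
    by rewrite WE /= psi_phi eqxx mulr1 rmorphM /= be_conj [be * _]mulrC.
  by rewrite WE /= psi_phi eq_sym (negbTE ne) mulr0 rmorph0 mul0r.
have innerC (X : finType) (u v : {ffun X -> C^o}) : inner u v = (inner v u)^*.
  rewrite /inner rmorph_sum; apply: eq_bigr => x _.
  by rewrite rmorphM /= conjCK mulrC.
exists (limg W); split.
  exists 0%N, en, U; split.
    split=> [u v|].
      rewrite /inner [RHS](reindex (fun x => glue (psi x))) /=.
        by apply: eq_bigr => x _; rewrite !UE.
      apply: onW_bij; apply: bij_comp; last by exists (fun w => phi w.1 w.2).
      exists (fun w => (data w, half w)) => w; last exact: glueK.
      by rewrite data_glue half_glue -surjective_pairing.
    apply/eqP; rewrite eqEsubv subvf /=; apply/subvP => v _ /=.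
    apply/memv_imgP; exists [ffun w => v (phi (data w) (half w))]; rewrite ?memvf //.
    by apply/ffunP => x; rewrite UE ffunE data_glue half_glue; have /= -> := psiK x.
  move=> v; split=> [/memv_imgP[f _ ->]|[f ->]]; first by exists f; rewrite -W_enc.
  by rewrite -/enc -W_enc memv_img ?memvf.
exists (W \o V)%VF; split.
  split.
  - by apply/lfunP => v; rewrite !comp_lfunE WK.
  - by move=> u v; rewrite !comp_lfunE W_adj [RHS]innerC W_adj -innerC.
  apply/eqP; rewrite eqEsubv; apply/andP; split.
    by rewrite limg_comp limgS ?subvf.
  apply/subvP => _ /memv_imgP[f _ ->]; apply/memv_imgP; exists (W f).
    exact: memvf.
  by rewrite comp_lfunE WK.
move=> E S cS [F EF].
(* Exactly [c] places are wanted, so that [s] and the restriction of [phi y s] to [T] determine each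
   other. *)
have [|T sST cT] := @superset_of_card _ S c.
  by rewrite -ltnS cS card_ord leq_addl.
pose x0 : word q 'I_(k + c) := [ffun _ => Ordinal q_gt0].
pose diagF (t : word q {i | i \in S}) : C := F [ffun t' => (t' == t)%:R] t.
(* The average of the diagonal entries of [F] over the [q^c] words on [T]; the filler [x0] lies
   outside [T], hence outside [S]. *)
exists (be * be *
  \sum_(u : word q {i | i \in T}) diagF (Defs.restrict S (overwrite x0 u))).
(* It suffices that [V (E (x) id) W] is multiplication by this scalar on the data space. *)
move=> v; rewrite !comp_lfunE /= -linearZ; congr (W _).
move: (V v) => f {v}; apply/ffunP => y; rewrite VE ffunE -[RHS]/(_ * _).
(* Off-diagonal terms vanish: a change inside [S] leading from [phi y s] to some [phi y' s] with
   [y' != y] leaves at least [k] places in agreement, against [phi_l]. *)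
transitivity (be * \sum_s be * f y * diagF (Defs.restrict S (phi y s))).
  congr (_ * _); apply: eq_bigr => s _; rewrite ffunE EF /diagF /=.
  rewrite (_ : [ffun _ => _] = (be * f y : C) *:
    [ffun t' => (t' == Defs.restrict S (phi y s))%:R]);
    first by rewrite linearZ ffunE.
  apply/ffunP => t; rewrite !ffunE WE /= -[RHS]/(_ * _).
  have [->|ne] := eqVneq t; first by rewrite overwrite_restrict psi_phi eqxx.
  rewrite mulr0; case: eqVneq => [e|]; last by rewrite mulr0.
  have /= xE := psiK (overwrite (phi y s) t); rewrite e in xE.
  have yE : y != (psi (overwrite (phi y s) t)).1.
    by apply: contra_neq ne => yE; rewrite -(restrict_overwrite (phi y s) t) -xE -yE.
  have := phi_l s yE; rewrite ltnNge => /negP[].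
  apply: (@leq_trans #|~: S|).
    by rewrite cardsCs setCK card_ord -addnBA ?leq_addr.
  apply/subset_leq_card/subsetP => i; rewrite !inE => /(overwrite_out (phi y s) t).
  by rewrite xE => ->.
rewrite -mulr_sumr -!mulrA; congr (_ * (_ * _)); rewrite mulrC; congr (_ * _).
rewrite [RHS](reindex (fun s => Defs.restrict T (phi y s))) /=.
  by apply: eq_bigr => s _; rewrite restrict_overwrite_sub.
(* Two values of [s] with the same restriction to [T] would agree in [c] places, against [phi_r];
   both sides count [q^c] words. *)
apply/onW_bij/inj_card_bij => [s s' /ffunP e|]; last first.
  by rewrite !card_ffun card_sig cT !card_ord.
apply/eqP; apply: contraT => /(phi_r y); rewrite ltnNge => /negP[].
rewrite -{1}cT; apply/subset_leq_card/subsetP => i Ti; rewrite inE.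
by have := e (exist _ i Ti); rewrite !ffunE /= => ->.
Qed.
End PermutationCode.

(** * Parameters and conclusion *)

Lemma MDS_max_entanglement_of_prime_power (C : numClosedFieldType)
    (q p m k : nat) :
  prime p -> (0 < m)%N -> q = (p ^ m)%N -> (1 <= k <= q + 1)%N ->
  MDS_max_entanglement_EAQECC_exists C q (q + 1) k (q + 2 - k) (q + 1 - k).
Proof.
move=> p_pr m0 qE /andP[k0 kq]; have [F _ cF] := PrimePowerField p_pr m0.
rewrite -qE in cF.
have q0 : (0 < q)%N by rewrite qE expn_gt0 prime_gt0.
split; [by rewrite /MDS_params; lia | by rewrite /max_entanglement_params; lia |].
(* Since [k <= q + 1], no subtraction is truncated: with [k + c = q + 1] the distance is [c + 1]. *)
have [c kc] : exists c, (k + c = q.+1)%N by exists (q.+1 - k)%N; lia.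
have -> : (q + 1 - k = c)%N by lia.
have -> : (q + 2 - k = c.+1)%N by lia.
have -> : (q + 1 = k + c)%N by lia.
have [phi [phi_inj phi_l phi_r]] := rs_words cF kc k0.
exact: permutation_code_EAQECC phi_r.
Qed.

Theorem theorem5p4 (R : realType) (q p m : nat)
    (hp : prime p) (hm : (0 < m)%N) (hq : q = (p ^ m)%N) :
  (~~ odd q -> forall k : nat, (1 <= k <= q + 1)%N ->
     MDS_max_entanglement_EAQECC_exists R[i]
       q (q + 1) k (q + 2 - k) (q + 1 - k))
  /\
  (odd q -> forall k : nat, odd k -> (1 <= k <= q + 1)%N ->
     MDS_max_entanglement_EAQECC_exists R[i]
       q (q + 1) k (q + 2 - k) (q + 1 - k)).

Proof.
by split=> [_ k|_ k _]; exact: MDS_max_entanglement_of_prime_power hq.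
Qed.
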